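(* Fix integers $n > d \ge 2$. The following hold, as $q \to +\infty$ over prime powers. (1) For all $1 \le k \le n-d$ we have $$\beta_k(q,n,d) = \binom{n}{d} q^{(k-1)(n-k)+d-1} + o \left( q^{(k-1)(n-k)+d-1}\right).$$ (2) In particular, $$\beta_k(q,n,d) \sim \begin{cases} \binom{n}{d} q^{(k-1)(n-k)+d-1} & \text{if } 1 \le k \le n-d, \\ q^{k(n-k)} & \text{if } n-d+1 \le k \le n.\end{cases}$$ (3) For all $1 \le k \le n$ we have $$\beta_k(q,n,d) \in O \left( q^{(k-1)(n-k)+d-1}\right).$$
   Context: For a prime power $q$ and integers $n\ge 1$, $k,d\ge 0$, $\beta_k(q,n,d)$ denotes the number of $k$-dimensional $\mathbb{F}_q$-linear subspaces (codes) $C\le\mathbb{F}_q^n$ with minimum Hamming distance at most $d$, i.e. containing a nonzero vector with at most $d$ nonzero coordinates. All asymptotic estimates (Bachmann–Landau notation $O$, $o$, $\sim$) are for $q\to+\infty$ with $q$ ranging over the prime powers, the other parameters $n,d,k$ being fixed constants. *)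

(* Defs.v *)
From HB Require Import structures.
From mathcomp Require Import all_boot all_order all_algebra all_field.
From mathcomp Require Import all_classical all_reals all_analysis.

Set Implicit Arguments.
Unset Strict Implicit.
Unset Printing Implicit Defensive.

Import Order.TTheory GRing.Theory Num.Theory.
Import numFieldNormedType.Exports.

Local Open Scope ring_scope.

(* vector.v gives {vspace V} no finType structure, which is needed to count
   subspaces; it is inherited here from the matrix encoding. *)
HB.instance Definition _ (F : finFieldType) (V : vectType F) :=
  CanIsCountable (@VectorInternalTheory.vs2mxK F V).
HB.instance Definition _ (F : finFieldType) (V : vectType F) :=
  fintype.isFinite.Build {vspace V}
    (pcan_enumP (can_pcan (@VectorInternalTheory.vs2mxK F V))).

Definition prime_power (q : nat) : Prop :=
  exists p m : nat, [/\ prime p, (0 < m)%N & q = (p ^ m)%N].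

Lemma pdiv_logn_gt0 (q : nat) : (1 < q)%N -> (0 < logn (pdiv q) q)%N.
Proof. by move=> q1; rewrite logn_gt0 pi_pdiv. Qed.

(* The finite field with q elements when q is a prime power (see card_GF);
   the value at other q is irrelevant. *)
Definition GF (q : nat) : finFieldType :=
  match ltnP 1 q with
  | LtnNotGeq q1 => s2val (pPrimePowerField (pdiv_prime q1) (pdiv_logn_gt0 q1))
  | GeqNotLtn _ => 'F_2
  end.

Lemma card_GF (q : nat) : prime_power q -> #|GF q| = q.
Proof.
case=> p [m [pp m0 ->]].
have pm1 : (1 < p ^ m)%N by rewrite -(exp1n m) ltn_exp2r // prime_gt1.
rewrite /GF; case: ltnP => [q1|]; last by rewrite leqNgt pm1.
rewrite (s2valP' (pPrimePowerField _ _)).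
have -> : pdiv (p ^ m) = p by case: m m0 {pm1 q1} => // m _; rewrite pdiv_pfactor.
by rewrite pfactorK.
Qed.

Definition hamming_weight (F : finFieldType) (n : nat) (v : 'rV[F]_n) : nat :=
  #|[pred i : 'I_n | v ord0 i != 0]|.

(* By linearity, the minimum Hamming distance of C is the least weight of a
   nonzero vector of C; the zero code satisfies this for no d. *)
Definition min_dist_le (F : finFieldType) (n : nat) (C : {vspace 'rV[F]_n})
    (d : nat) : bool :=
  [exists v : 'rV[F]_n, [&& v \in C, v != 0 & (hamming_weight v <= d)%N]].

Definition beta (k q n d : nat) : nat :=
  #|[pred C : {vspace 'rV[GF q]_n} | (\dim C == k) && min_dist_le C d]|.

(* Neighbourhoods of +oo among the prime powers. *)
Definition prime_powers_oo : set_system nat := within prime_power (\oo)%classic.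

#[global] Instance prime_powers_oo_proper : ProperFilter prime_powers_oo.
Proof.
apply: Build_ProperFilter => -[N _ hN].
have [p Np pp] := prime_above N.
by apply: (hN p (ltnW Np)); exists p, 1%N; split; rewrite ?expn1.
Qed.

(* Main.v *)
Require Import Defs.
From mathcomp Require Import all_boot all_order all_algebra all_field.
From mathcomp Require Import all_classical all_reals all_analysis.
From mathcomp Require Import zify ring.
Import Order.TTheory GRing.Theory Num.Theory.
Import numFieldNormedType.Exports.
Local Open Scope ring_scope.

(** A code has minimum distance at most d exactly when it meets the set B of
    nonzero vectors of weight at most d.  Over the field with q elements the
    sphere of radius i has C(n,i) (q-1)^i vectors, so B is made of about
    C(n,d) q^(d-1) punctured lines ([card_low_weight]).  A fixed line lies in
    about q^((k-1)(n-k)) spaces of dimension k, and a fixed plane in about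
    q^((k-2)(n-k)), because the number N(W) of k-spaces over a w-dimensional W
    is the product of (q^n - q^i) / (q^k - q^i) for w <= i < k
    ([card_subspaces_over]).

    Counting the pairs (line of B, k-space containing it) bounds beta from
    above by C(n,d) q^((k-1)(n-k)+d-1), up to lower order terms
    ([low_distance_codes_upper]).  A code with several lines in B is counted
    several times there; by a Bonferroni inequality the excess is at most the
    number of triples (two independent vectors of B, k-space containing both),
    divided by (q-1)^2 ([low_distance_codes_lower]).  This quotient is
    O(q^(2(d-1)+(k-2)(n-k))), smaller than the main term by a factor
    q^(n-k-d+1).  When k <= n - d this factor is at least q, and the
    squeeze gives the limit of beta / q^((k-1)(n-k)+d-1).

    When k > n - d every code qualifies ([singleton_bound]), so beta is the
    Gaussian binomial coefficient, equivalent to q^(k(n-k)); moreover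
    n - k <= d - 1 then gives k(n-k) <= (k-1)(n-k)+d-1, whence the upper
    bound of the third claim.

    For the limits, everything is expressed through x = 1/q: each count is a
    power of q times a polynomial or a quotient of polynomials in x, and it
    only remains to evaluate these at x = 0. *)

(** * Subspaces of given dimension containing a given subspace *)

Definition subspaces_over {F : finFieldType} {n : nat}
    (W : {vspace 'rV[F]_n}) (k : nat) : {set {vspace 'rV[F]_n}} :=
  [set C : {vspace 'rV[F]_n} | (W <= C)%VS && (\dim C == k)].

Lemma dim_rV (F : finFieldType) (n : nat) : \dim {: 'rV[F]_n} = n.
Proof. by rewrite dimvf dim_matrix; exact: mul1n. Qed.

(** Double count of the pairs (v, C) where C has dimension k, contains W, and v
    is in C but not in W: for such v, containing W and v means containing
    W + <[v]>. *)
Lemma card_subspaces_over_step (F : finFieldType) (n k M : nat)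
    (W : {vspace 'rV[F]_n}) :
  (forall v, v \notin W -> #|subspaces_over (W + <[v]>)%VS k| = M) ->
  (#|subspaces_over W k| * (#|F| ^ k - #|F| ^ \dim W)
   = (#|F| ^ n - #|F| ^ \dim W) * M)%N.
Proof.
move=> hM.
have cardD (C : {vspace 'rV[F]_n}) : (W <= C)%VS ->
    #|[pred v | (v \in C) && (v \notin W)]| = (#|F| ^ \dim C - #|F| ^ \dim W)%N.
  move=> sWC; rewrite -!card_vspace -[#|C|](cardID (mem W)).
  have -> : #|[predI C & W]| = #|W|.
    by apply: eq_card => v; rewrite !inE; apply/andb_idl/(subvP sWC).
  by rewrite addKn; apply: eq_card => v; rewrite !inE andbC.
transitivity (\sum_(C in subspaces_over W k)
               \sum_(v | (v \in C) && (v \notin W)) 1)%N.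
  rewrite -sum_nat_const; apply: eq_bigr => C.
  rewrite inE => /andP[sWC /eqP dC].
  by rewrite sum1_card cardD // dC.
rewrite (exchange_big_dep (fun v => v \notin W)) /=; last first.
  by move=> ? ? _ /andP[].
transitivity (\sum_(v | v \notin W) M)%N.
  apply: eq_bigr => v vW; rewrite -(hM v vW) sum1_card; apply: eq_card => C.
  by rewrite unfold_in /= !inE subv_add -memvE vW andbT andbAC.
rewrite (sum_nat_const [pred v | v \notin W]); congr (_ * _)%N.
have := cardD _ (subvf W); rewrite dim_rV => <-.
by apply: eq_card => v; rewrite !inE memvf.
Qed.

Lemma dim_add_vline (F : finFieldType) (n : nat) (W : {vspace 'rV[F]_n}) v :
  v \notin W -> \dim (W + <[v]>) = (\dim W).+1.
Proof.
move=> vW; rewrite dimv_disjoint_sum ?dim_vline.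
  have -> : v != 0 by apply: contraNneq vW => ->; rewrite mem0v.
  by rewrite /= addn1.
apply/eqP; rewrite -subv0; apply/subvP => u; rewrite memv_cap => /andP[uW].
case/vlineP => a ua; rewrite memv0 ua; have [->|a0] := eqVneq a 0.
  by rewrite scale0r.
case/negP: vW; rewrite -[v]scale1r -(mulVf a0) -scalerA -ua; exact: memvZ.
Qed.

(** Descending induction on the dimension of W: each step of the double count
    contributes one factor to both products, down to the case where W itself
    is the only k-space over W.  The multiplied-out form avoids divisions in
    nat. *)
Lemma card_subspaces_over (F : finFieldType) (n k : nat)
    (W : {vspace 'rV[F]_n}) : (\dim W <= k)%N ->
  (#|subspaces_over W k| * \prod_(\dim W <= i < k) (#|F| ^ k - #|F| ^ i)
   = \prod_(\dim W <= i < k) (#|F| ^ n - #|F| ^ i))%N.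
Proof.
have [m] := ubnP (k - \dim W)%N; elim: m W => // m IH W hm; rewrite leq_eqVlt.
case/predU1P=> [dW|ltWk].
  rewrite !big_geq ?dW // muln1; apply/eqP/cards1P; exists W; apply/setP => C.
  rewrite !inE; apply/andP/eqP => [[sWC /eqP dC]|->]; last by rewrite dW subvv.
  by symmetry; apply/eqP; rewrite eqEdim sWC dC dW leqnn.
pose P := (\prod_((\dim W).+1 <= i < k) (#|F| ^ k - #|F| ^ i))%N.
pose Q := (\prod_((\dim W).+1 <= i < k) (#|F| ^ n - #|F| ^ i))%N.
have F1 : (1 < #|F|)%N by exact: finNzRing_gt1.
have P0 : (0 < P)%N.
  rewrite /P big_seq_cond prodn_cond_gt0 // => i.
  by rewrite mem_index_iota andbT => /andP[_ ik]; rewrite subn_gt0 ltn_exp2l.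
(* The induction hypothesis determines the count over W + <[v]>, and it does
   not depend on v. *)
have step v : v \notin W -> #|subspaces_over (W + <[v]>)%VS k| = (Q %/ P)%N.
  move=> vW; have := IH (W + <[v]>)%VS; rewrite dim_add_vline // -/P -/Q.
  by move=> <-; rewrite ?mulnK //; lia.
rewrite 2?(big_ltn ltWk) mulnA (card_subspaces_over_step _ _ _ _ _ step).
rewrite -/P -/Q.
have [[v vW]|allW] := altP (@existsP _ (fun v => v \notin W)).
  rewrite -mulnA -(step v vW); congr muln.
  by have := IH (W + <[v]>)%VS; rewrite dim_add_vline // -/P -/Q; apply; lia.
(* No vector lies outside W: then W is the whole space and q^n - q^n = 0. *)
rewrite (_ : _ - _ = 0)%N ?mul0n //; apply/eqP; rewrite subn_eq0 leq_exp2l //.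
have /dimvS : (fullv <= W)%VS; last by rewrite dim_rV.
apply/subvP => v _; move/existsPn/(_ v): allW; rewrite negbK; exact: id.
Qed.

(** * Vectors of low weight *)

(** A vector of weight i is the choice of its support A, of cardinality i, and
    of a function from A to the nonzero scalars. *)
Lemma card_hamming_sphere (F : finFieldType) (n i : nat) :
  #|[pred v : 'rV[F]_n | hamming_weight v == i]| = ('C(n, i) * #|F|.-1 ^ i)%N.
Proof.
pose supp (v : 'rV[F]_n) := [set j | v ord0 j != 0].
have suppE v : hamming_weight v = #|supp v| by rewrite cardsE.
rewrite -sum1_card (partition_big supp (fun A => #|A| == i)) /=; last first.
  by move=> v; rewrite unfold_in /= suppE.
rewrite -[n in 'C(n, i)]card_ord -card_draws -sum_nat_const.
rewrite [RHS](eq_bigl (fun A : {set 'I_n} => #|A| == i)); last first.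
  by move=> A; rewrite inE.
apply: eq_bigr => A /eqP cA; rewrite sum1_card.
have <- : #|predC1 (0 : F)| = #|F|.-1 by rewrite cardC1.
rewrite -cA -(card_pffun_on 0 A (predC1 (0 : F))).
pose f (v : 'rV[F]_n) := [ffun j => v ord0 j].
have f_inj : injective f.
  by move=> u v /ffunP e; apply/rowP => j; have := e j; rewrite !ffunE.
rewrite -(card_imset _ f_inj); apply: eq_card => g.
apply/imsetP/pffun_onP => [[v]|[sg hg]].
  rewrite unfold_in => /andP[_ /eqP sv] ->; split.
    by apply/fintype.subsetP => j; rewrite inE ffunE -sv inE.
  by move=> x /fintype.imageP[j]; rewrite -sv inE ffunE => ? ->.
exists (\row_j g j); last by apply/ffunP => j; rewrite !(ffunE, mxE).
have sE : supp (\row_j g j) = A.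
  apply/setP => j; rewrite inE mxE; apply/idP/idP => [gj|jA].
    by apply: (fintype.subsetP sg); rewrite inE.
  by have := hg _ (fintype.image_f g jA); rewrite inE.
rewrite unfold_in; apply/andP; split; last exact/eqP.
move: (suppE (\row_j g j)); rewrite sE cA => e; exact/eqP.
Qed.

Definition low_weight {F : finFieldType} {n : nat} (d : nat) : {set 'rV[F]_n} :=
  [set v | (v != 0) && (hamming_weight v <= d)%N].

Lemma hamming_weight_eq0 (F : finFieldType) (n : nat) (v : 'rV[F]_n) :
  (hamming_weight v == 0)%N = (v == 0).
Proof.
apply/idP/eqP => [|->].
  move/pred0P => h; apply/rowP => j; have := h j.
  by rewrite !inE mxE => /negbFE/eqP.
by apply/pred0P => j /=; rewrite mxE eqxx.
Qed.

Lemma hamming_weightZ (F : finFieldType) (n : nat) (a : F) (v : 'rV[F]_n) :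
  a != 0 -> hamming_weight (a *: v) = hamming_weight v.
Proof.
by move=> a0; apply: eq_card => j; rewrite !inE mxE mulf_eq0 (negbTE a0).
Qed.

Lemma card_low_weight (F : finFieldType) (n d : nat) :
  #|@low_weight F n d| = (\sum_(1 <= i < d.+1) 'C(n, i) * #|F|.-1 ^ i)%N.
Proof.
elim: d => [|d IH].
  rewrite big_geq //; apply/eqP; rewrite cards_eq0; apply/eqP/setP => v.
  by rewrite !inE leqn0 hamming_weight_eq0 andNb.
rewrite big_nat_recr //= -IH -card_hamming_sphere.
rewrite -[LHS](cardsID (low_weight d)); congr (_ + _)%N; apply: eq_card => v.
  by rewrite !inE; case: eqP => //= _; lia.
by rewrite !inE -hamming_weight_eq0 /=; case: eqP => /= e; lia.
Qed.

(** * Counting the codes of low minimum distance *)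

Definition low_distance_codes (F : finFieldType) (n d k : nat) :
    {set {vspace 'rV[F]_n}} :=
  [set C : {vspace 'rV[F]_n} | (\dim C == k) && min_dist_le C d].

Definition low_weight_in {F : finFieldType} {n : nat} (d : nat)
    (C : {vspace 'rV[F]_n}) : {set 'rV[F]_n} :=
  [set v in low_weight d | v \in C].

(** The weight is invariant under nonzero scalars, so the vectors of low weight
    in C are partitioned into punctured lines of size q - 1. *)
Lemma low_weight_in_line (F : finFieldType) (n d : nat) (C : {vspace 'rV[F]_n})
    (u : 'rV[F]_n) : u \in low_weight_in d C ->
  #|[set v in low_weight_in d C | v \in <[u]>%VS]| = #|F|.-1.
Proof.
rewrite !inE => /andP[/andP[u0 wu] uC].
transitivity #|[predD1 <[u]>%VS & 0]|.
  apply: eq_card => v; rewrite !inE; case: (v \in _) / vlineP => [[a ->]|_];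
    last by rewrite !andbF.
  rewrite !andbT scaler_eq0 (negbTE u0) orbF; have [//|a0] := eqVneq a 0.
  by rewrite hamming_weightZ // wu memvZ.
have := cardD1 0 <[u]>%VS; rewrite mem0v card_vspace dim_vline u0 expn1 => ->.
by rewrite add1n.
Qed.

Lemma low_weight_in_gt0 (F : finFieldType) (n d : nat) (C : {vspace 'rV[F]_n}) :
  (0 < #|low_weight_in d C|)%N = min_dist_le C d.
Proof.
rewrite card_gt0; apply/set0Pn/existsP => [] [v hv]; exists v; move: hv;
  by rewrite !inE andbC ?andbA // -andbA.
Qed.

Lemma sum_card_low_weight_in (F : finFieldType) (n d k M : nat) :
  (forall v : 'rV[F]_n, v != 0 -> #|subspaces_over <[v]> k| = M) ->
  (\sum_(C : {vspace 'rV[F]_n} | \dim C == k) #|low_weight_in d C|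
   = #|@low_weight F n d| * M)%N.
Proof.
move=> hM; rewrite -sum_nat_const.
transitivity (\sum_(C : {vspace 'rV[F]_n} | \dim C == k)
               \sum_(v in low_weight_in d C) 1)%N.
  by apply: eq_bigr => C _; rewrite sum1_card.
rewrite (exchange_big_dep (fun v => v \in low_weight d)) /=; last first.
  by move=> C v _; rewrite inE => /andP[].
apply: eq_bigr => v vB; rewrite sum1_card.
have v0 : v != 0 by move: vB; rewrite inE => /andP[].
rewrite -(hM v v0); apply: eq_card => C.
by rewrite unfold_in [v \in low_weight_in _ _]inE vB [RHS]inE -memvE andbC.
Qed.

(** A code of minimum distance at most d has at least one punctured line, that
    is q - 1 vectors, of low weight; the total number of pairs (vector of low
    weight, k-space containing it) is then large enough. *)
Lemma low_distance_codes_upper (F : finFieldType) (n d k M : nat) :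
  (forall v : 'rV[F]_n, v != 0 -> #|subspaces_over <[v]> k| = M) ->
  (#|low_distance_codes F n d k| * #|F|.-1 <= #|@low_weight F n d| * M)%N.
Proof.
move=> hM; rewrite -(sum_card_low_weight_in _ _ _ _ _ hM) -sum_nat_const.
rewrite (eq_bigl
  (fun C : {vspace 'rV[F]_n} => (\dim C == k) && min_dist_le C d));
  last by move=> C; rewrite inE.
rewrite big_mkcondr; apply: leq_sum => C _; case: ifP => //.
rewrite -low_weight_in_gt0 card_gt0 => /set0Pn[u uC].
rewrite -(low_weight_in_line _ _ _ _ _ uC) subset_leq_card //.
by rewrite setIdE subsetIl.
Qed.

(** Each pair (u, v) counted here spans a plane of C, so the sum over all codes
    is controlled by the number of k-spaces over a plane. *)
Definition indep_pairs {F : finFieldType} {n : nat} (d : nat)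
    (C : {vspace 'rV[F]_n}) : nat :=
  (\sum_(u in low_weight_in d C)
     \sum_(v in low_weight_in d C | v \notin <[u]>%VS) 1)%N.

Lemma sqr_card_low_weight_in (F : finFieldType) (n d : nat)
    (C : {vspace 'rV[F]_n}) :
  (#|low_weight_in d C| ^ 2 =
   indep_pairs d C + #|low_weight_in d C| * #|F|.-1)%N.
Proof.
rewrite expnS expn1 -!sum_nat_const -big_split; apply: eq_bigr => u uC /=.
rewrite -(low_weight_in_line _ _ _ _ _ uC) sum1_card addnC.
rewrite -[LHS](cardID (mem <[u]>%VS)).
congr (_ + _)%N; apply: eq_card => v; first by rewrite !inE.
by rewrite [RHS]unfold_in [in RHS]andbC !inE.
Qed.

Lemma sum_indep_pairs (F : finFieldType) (n d k M : nat) :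
  (forall W : {vspace 'rV[F]_n},
     \dim W = 2 -> (#|subspaces_over W k| <= M)%N) ->
  (\sum_(C : {vspace 'rV[F]_n} | \dim C == k) indep_pairs d C
   <= #|@low_weight F n d| ^ 2 * M)%N.
Proof.
move=> hM.
rewrite (exchange_big_dep (fun u => u \in low_weight d)) /=; last first.
  by move=> C v _; rewrite inE => /andP[].
rewrite expnS expn1 -mulnA -[X in (_ <= X)%N]sum_nat_const.
apply: leq_sum => u uB.
rewrite (exchange_big_dep
  (fun v => (v \in low_weight d) && (v \notin <[u]>%VS))) /=;
  last by move=> C v _ /andP[]; rewrite inE => /andP[-> _] ->.
rewrite -[X in (_ <= X)%N]sum_nat_const.
rewrite [X in (_ <= X)%N](bigID (fun v => v \notin <[u]>%VS)).
apply: leq_trans (leq_addr _ _); apply: leq_sum => v /andP[vB vu].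
rewrite sum1_card; apply: leq_trans (hM (<[u]> + <[v]>)%VS _); last first.
  by rewrite dim_add_vline // dim_vline; move: uB; rewrite inE => /andP[->].
apply/subset_leq_card/fintype.subsetP => C.
rewrite unfold_in !inE subv_add -!memvE.
by move=> /andP[/andP[-> /andP[_ ->]] /andP[/andP[_ ->] _]].
Qed.

(** Bonferroni inequality.  With m the number of low weight vectors of C, the
    summand of a code with m > 0 compares (q-1) m with
    (q-1)^2 + m^2 - (q-1) m, that is, it says (m - (q-1))^2 >= 0; this form
    never divides m by q - 1. *)
Lemma low_distance_codes_lower (F : finFieldType) (n d k M1 M2 : nat) :
  (forall v : 'rV[F]_n, v != 0 -> #|subspaces_over <[v]> k| = M1) ->
  (forall W : {vspace 'rV[F]_n},
     \dim W = 2 -> (#|subspaces_over W k| <= M2)%N) ->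
  (#|F|.-1 * (#|@low_weight F n d| * M1) <=
   #|low_distance_codes F n d k| * #|F|.-1 ^ 2
   + #|@low_weight F n d| ^ 2 * M2)%N.
Proof.
move=> h1 h2; rewrite -(sum_card_low_weight_in _ _ _ _ _ h1) -sum_nat_const.
apply: leq_trans (leq_add (leqnn _) (sum_indep_pairs _ _ _ _ _ h2)).
rewrite [X in (_ <= X + _)%N](eq_bigl
  (fun C : {vspace 'rV[F]_n} => (\dim C == k) && min_dist_le C d));
  last by move=> C; rewrite inE.
rewrite big_mkcondr -big_split big_distrr; apply: leq_sum => C _ /=.
rewrite -low_weight_in_gt0; have := sqr_card_low_weight_in F n d C.
move: (#|low_weight_in d C|) (indep_pairs d C) => m I e.
have [->|m0] := posnP m; first by rewrite muln0.
have := (nat_Cauchy #|F|.-1 m).1; rewrite e mul2n -addnn [(m * _)%N]mulnC addnA.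
by rewrite leq_add2r.
Qed.

(** The Singleton bound: forgetting all but n - d coordinates cannot be
    injective on a code with more than q^(n-d) words, and the difference of
    two words that collide has weight at most d. *)
Lemma singleton_bound (F : finFieldType) (n d : nat) (C : {vspace 'rV[F]_n}) :
  (n - d < \dim C)%N -> min_dist_le C d.
Proof.
move=> hC; have F1 : (1 < #|F|)%N by exact: finNzRing_gt1.
pose p (v : 'rV[F]_n) : {ffun 'I_(n - d) -> F} :=
  [ffun j => v ord0 (widen_ord (leq_subr d n) j)].
have : ~~ [forall u in C, forall v in C, (p u == p v) ==> (u == v)].
  apply/negP => inj; suff : (#|C| <= #|{ffun 'I_(n - d) -> F}|)%N.
    by rewrite card_vspace card_ffun card_ord leq_exp2l // leqNgt hC.
  apply: (leq_card_in p) => u v uC vC puv; apply/eqP.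
  move/forall_inP/(_ u uC)/forall_inP/(_ v vC): inj.
  by rewrite puv eqxx.
case/forall_inPn => u uC /forall_inPn[v vC]; rewrite negb_imply.
case/andP=> /eqP/ffunP puv uv; apply/existsP; exists (u - v).
rewrite rpredB // subr_eq0 uv /=.
have sub : [pred j | (u - v) ord0 j != 0]
    \subset [pred j : 'I_n | (n - d <= j)%N].
  apply/fintype.subsetP => j; rewrite !inE !mxE leqNgt; apply: contraNN => jd.
  have := puv (Ordinal jd); rewrite !ffunE.
  rewrite (_ : widen_ord _ _ = j) => [->|]; last exact: val_inj.
  by rewrite subrr.
apply: leq_trans (subset_leq_card sub) _.
have -> : #|[pred j : 'I_n | (n - d <= j)%N]| = (n - (n - d))%N.
  transitivity (\sum_(n - d <= i < n) 1)%N; last first.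
    by rewrite sum_nat_const_nat muln1.
  by rewrite big_geq_mkord sum1_card.
by lia.
Qed.

(** * The counts as functions of 1/q *)

(** Since q^n - q^i = q^n (1 - (1/q)^(n-i)), this is the product of the
    q^n - q^i without its leading power of q, as a polynomial in 1/q. *)
Definition qfactors (R : nzRingType) (n k w : nat) : {poly R} :=
  \prod_(w <= i < k) (1 - 'X^(n - i)).

(** For w <= k <= n, its value at x = 1/q is the number of k-spaces over a
    w-dimensional subspace of the n-dimensional space, divided by
    q^((n-k)(k-w)). *)
Definition gauss_tail (R : realType) (n k w : nat) (x : R) : R :=
  (qfactors R n k w).[x] / (qfactors R k k w).[x].

Lemma prod_subX (R : realType) (n k w q : nat) : (k <= n)%N -> (0 < q)%N ->
  (\prod_(w <= i < k) (q ^ n - q ^ i))%:R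
  = q%:R ^+ (n * (k - w)) * (qfactors R n k w).[q%:R^-1] :> R.
Proof.
move=> kn q0; have Q0 : q%:R != 0 :> R by rewrite pnatr_eq0 -lt0n.
rewrite natr_prod /qfactors horner_prod exprM -prodr_const_nat -big_split /=.
apply: eq_big_nat => i /andP[_ ik].
rewrite natrB ?leq_pexp2l //; last by lia.
rewrite !natrX !hornerE mulrBr mulr1; congr (_ - _).
have -> : q%:R ^+ n = q%:R ^+ i * q%:R ^+ (n - i) :> R.
  by rewrite -exprD subnKC //; lia.
by rewrite -mulrA -exprMn divff // expr1n mulr1.
Qed.

Lemma qfactors_gt0 (R : realType) (n k w : nat) (x : R) :
  (k <= n)%N -> 0 <= x < 1 -> 0 < (qfactors R n k w).[x].
Proof.
move=> kn /andP[x0 x1]; rewrite /qfactors horner_prod big_seq prodr_gt0 // => i.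
rewrite mem_index_iota => /andP[_ ik]; rewrite !hornerE subr_gt0.
by rewrite exprn_ilt1 //; lia.
Qed.

Lemma qfactors0 (R : realType) (n k w : nat) :
  (k <= n)%N -> (qfactors R n k w).[0] = 1.
Proof.
move=> kn; rewrite /qfactors horner_prod big_nat big1 // => i /andP[_ ik].
by rewrite !hornerE expr0n (_ : _ == _ = false) ?subr0 //; lia.
Qed.

Lemma card_subspaces_over_real (R : realType) (F : finFieldType) (n k w : nat)
    (W : {vspace 'rV[F]_n}) : \dim W = w -> (w <= k <= n)%N ->
  #|subspaces_over W k|%:R
  = #|F|%:R ^+ ((n - k) * (k - w)) * gauss_tail R n k w #|F|%:R^-1 :> R.
Proof.
move=> dW /andP[Wk kn]; rewrite -dW in Wk *.
have F1 : (1 < #|F|)%N by exact: finNzRing_gt1.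
have F0 : (0 < #|F|)%N by lia.
have Q0 : #|F|%:R != 0 :> R by rewrite pnatr_eq0 -lt0n.
have /(congr1 (GRing.natmul (1 : R))) := card_subspaces_over _ _ _ _ Wk.
rewrite natrM !prod_subX //.
have D0 : (qfactors R k k (\dim W)).[#|F|%:R^-1] != 0.
  by rewrite gt_eqF // qfactors_gt0 // invr_ge0 ler0n invf_lt1 ?ltr1n // ltr0n.
move=> e; apply: (mulIf (mulf_neq0 (expf_neq0 (k * (k - \dim W)) Q0) D0)).
rewrite e /gauss_tail mulnBl.
have -> : #|F|%:R ^+ (n * (k - \dim W)) =
   #|F|%:R ^+ (n * (k - \dim W) - k * (k - \dim W))
   * #|F|%:R ^+ (k * (k - \dim W)) :> R.
  by rewrite -exprD subnK // leq_mul2r kn orbT.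
by field.
Qed.

(** For d > 0, its value at x = 1/q is the number of lines spanned by vectors
    of weight at most d, divided by q^(d-1). *)
Definition ball_poly (R : nzRingType) (n d : nat) : {poly R} :=
  \sum_(1 <= i < d.+1) 'C(n, i)%:R *: ((1 - 'X) ^+ (i - 1) * 'X^(d - i)).

Lemma card_low_weight_real (R : realType) (F : finFieldType) (n d : nat) :
  (0 < d)%N ->
  #|@low_weight F n d|%:R
  = #|F|.-1%:R * #|F|%:R ^+ (d - 1) * (ball_poly R n d).[#|F|%:R^-1] :> R.
Proof.
move=> d0.
have F1 : (1 < #|F|)%N by exact: finNzRing_gt1.
have Q0 : #|F|%:R != 0 :> R by rewrite pnatr_eq0; lia.
rewrite card_low_weight natr_sum /ball_poly horner_sum mulr_sumr.
apply: eq_big_nat => i /andP[i1 id].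
rewrite natrM natrX !hornerE.
have -> : #|F|.-1%:R = #|F|%:R * (1 - #|F|%:R^-1) :> R.
  by rewrite mulrBr divff // mulr1 -subn1 natrB //; lia.
have -> : #|F|%:R ^+ (d - 1) = #|F|%:R ^+ (i - 1) * #|F|%:R ^+ (d - i) :> R.
  by rewrite -exprD; congr (_ ^+ _); lia.
have -> : #|F|%:R^-1 ^+ (d - i) = (#|F|%:R ^+ (d - i))^-1 :> R.
  by rewrite exprVn.
have pE (y : R) : y ^+ i = y * y ^+ (i - 1).
  by rewrite -exprS; congr (_ ^+ _); lia.
have : #|F|%:R ^+ (d - i) != 0 :> R by exact: expf_neq0.
rewrite pE exprMn; set a := 1 - _.
move: (a ^+ _) (_ ^+ (i - 1)) (_ ^+ (d - i)) => y z t t0.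
by clearbody a; rewrite /=; field.
Qed.

Lemma ball_poly0 (R : realType) (n d : nat) : (0 < d)%N ->
  (ball_poly R n d).[0] = 'C(n, d)%:R.
Proof.
move=> d0; rewrite /ball_poly horner_sum big_nat_recr //= big_nat.
rewrite big1 => [|i /andP[i1 id]].
  by rewrite add0r !hornerE /= subnn expr0 subr0 expr1n !mulr1.
by rewrite !hornerE /= expr0n (_ : _ == _ = false) ?mulr0 //; lia.
Qed.

Definition dominant_exponent (n d k : nat) : nat :=
  ((k - 1) * (n - k) + d - 1)%N.

(** The two counting bounds after division by q^((k-1)(n-k)+d-1).  The error
    term carries the power x^(n-k-(d-1)), of positive exponent as soon as
    k <= n - d. *)
Lemma low_distance_codes_squeeze (R : realType) (F : finFieldType) (n d k : nat)
    (x := #|F|%:R^-1 : R)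
    (U := (ball_poly R n d).[x] * gauss_tail R n k 1 x) :
  (0 < d)%N -> (0 < k <= n - d)%N ->
  U - x ^+ (n - k - (d - 1))
      * ((ball_poly R n d).[x] ^+ 2 * gauss_tail R n k 2 x)
  <= #|low_distance_codes F n d k|%:R / #|F|%:R ^+ dominant_exponent n d k
  <= U.
Proof.
move=> d0 /andP[k0 knd]; have kn : (k <= n)%N by lia.
have F1 : (1 < #|F|)%N by exact: finNzRing_gt1.
have Q0 : 0 < #|F|%:R :> R by rewrite ltr0n; lia.
have P0 : 0 < #|F|.-1%:R :> R by rewrite ltr0n; lia.
have eE : #|F|%:R ^+ dominant_exponent n d k =
    #|F|%:R ^+ (d - 1) * #|F|%:R ^+ ((n - k) * (k - 1)) :> R.
  by rewrite -exprD /dominant_exponent; congr (_ ^+ _); nia.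
have bE := card_low_weight_real R F n d d0.
set B := (ball_poly R n d).[x] in U bE *.
have [v0 v0P] : exists v : 'rV[F]_n, v != 0.
  exists (const_mx 1); apply/negP => /eqP/rowP/(_ (Ordinal (_ : 0 < n)%N)).
  have n0 : (0 < n)%N by lia.
  by move/(_ n0); rewrite !mxE => /eqP; rewrite oner_eq0.
pose M1 := #|subspaces_over <[v0]> k|.
have M1E : M1%:R = #|F|%:R ^+ ((n - k) * (k - 1)) * gauss_tail R n k 1 x :> R.
  by rewrite (card_subspaces_over_real _ _ _ _ 1) ?dim_vline ?v0P ?k0.
have h1 (v : 'rV[F]_n) : v != 0 -> #|subspaces_over <[v]> k| = M1.
  move=> v0'; apply/eqP; rewrite -(eqr_nat R) M1E.
  by rewrite (card_subspaces_over_real _ _ _ _ 1) ?dim_vline ?v0' ?k0.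
(* T bounds the number of k-spaces over a plane.  Writing q^((k-2)(n-k)) as
   q^((k-1)(n-k)) x^(n-k) also covers k = 1, where that number is 0 but k - 2
   would be truncated. *)
pose T := #|F|%:R ^+ ((n - k) * (k - 1)) * x ^+ (n - k) * gauss_tail R n k 2 x.
have g2 : 0 <= gauss_tail R n k 2 x.
  have x01 : 0 <= x < 1 by rewrite invr_ge0 ler0n invf_lt1 ?ltr1n.
  by rewrite divr_ge0 // ltW // qfactors_gt0.
have x0 : 0 <= x by rewrite invr_ge0 ler0n.
have T0 : 0 <= T by apply: mulr_ge0 => //; apply: mulr_ge0; apply: exprn_ge0.
(* The counting bound takes a natural number: truncating T loses nothing. *)
have h2 (W : {vspace 'rV[F]_n}) : \dim W = 2 ->
    (#|subspaces_over W k| <= Num.Def.trunc T)%N.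
  move=> W2; rewrite truncn_ge_nat //; have [k1|k2] := leqP k 1.
    rewrite (_ : #|_| = 0)%N //; apply/eqP; rewrite cards_eq0.
    apply/eqP/setP => C.
    rewrite !inE; apply/negP => /andP[/dimvS + /eqP dC]; rewrite dC W2; lia.
  rewrite (card_subspaces_over_real _ _ _ _ 2) ?k2 // /T ler_wpM2r //.
  rewrite /x exprVn.
  have -> : ((n - k) * (k - 1) = (n - k) * (k - 2) + (n - k))%N by nia.
  by rewrite exprD mulfK // expf_neq0 // gt_eqF.
set beta := #|low_distance_codes F n d k|.
have up : beta%:R * #|F|.-1%:R <= #|@low_weight F n d|%:R * M1%:R :> R.
  by rewrite -!natrM ler_nat low_distance_codes_upper.
have lo : #|F|.-1%:R * (#|@low_weight F n d|%:R * M1%:R) <=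
    beta%:R * #|F|.-1%:R ^+ 2 + #|@low_weight F n d|%:R ^+ 2 * T :> R.
  apply: le_trans (_ : _ <= beta%:R * #|F|.-1%:R ^+ 2 +
      #|@low_weight F n d|%:R ^+ 2 * (Num.Def.trunc T)%:R) _.
    rewrite -!natrX -!natrM -natrD ler_nat; exact: low_distance_codes_lower.
  by rewrite lerD2l ler_wpM2l ?exprn_ge0 ?truncn_le.
rewrite ler_pdivrMr ?ler_pdivlMr ?exprn_gt0 // eE.
move: up lo; rewrite M1E bE.
set A := #|F|%:R ^+ (d - 1); set D := #|F|%:R ^+ _.
set g := gauss_tail R n k 1 x in U *; set p := #|F|.-1%:R in P0 *.
move=> up lo; apply/andP; split; last first.
  rewrite -(ler_pM2r P0); apply: le_trans up _.
  rewrite le_eqVlt; apply/orP; left; apply/eqP.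
  by rewrite /U; ring.
have -> : x ^+ (n - k - (d - 1)) = x ^+ (n - k) * A.
  have nkE : (n - k - (d - 1) + (d - 1) = n - k)%N by lia.
  by rewrite -[in RHS]nkE exprD /A -mulrA -exprMn mulVf ?gt_eqF // expr1n mulr1.
rewrite -(ler_pM2r (exprn_gt0 2 P0)); move: lo; rewrite -lerBlDr.
apply: le_trans; rewrite le_eqVlt; apply/orP; left; apply/eqP.
by rewrite /U /T -/D; ring.
Qed.

(** * Limits along the prime powers *)

Lemma cvg_inv_prime_powers (R : realType) :
  ((fun q : nat => q%:R^-1 : R) @ prime_powers_oo --> (0 : R))%classic.
Proof.
apply: cvg_trans (_ : (fun q : nat => q%:R^-1 : R) @ \oo --> (0 : R))%classic.
  apply: cvg_app; exact: cvg_within.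
apply/gtr0_cvgV0; last exact: cvgr_idn.
by near=> q; rewrite ltr0n; near: q; exact: nbhs_infty_gt.
Unshelve. all: by end_near.
Qed.

Lemma cvg_horner_inv (R : realType) (p : {poly R}) :
  ((fun q : nat => p.[q%:R^-1]) @ prime_powers_oo --> p.[0])%classic.
Proof.
apply: (@cvg_comp _ _ _ (fun q : nat => q%:R^-1) (horner p)).
  exact: cvg_inv_prime_powers.
exact: continuous_horner.
Qed.

Lemma cvg_gauss_tail (R : realType) (n k w : nat) : (k <= n)%N ->
  ((fun q : nat => gauss_tail R n k w q%:R^-1)
     @ prime_powers_oo --> (1 : R))%classic.
Proof.
move=> kn; have nz : (qfactors R k k w).[0] != 0.
  by rewrite qfactors0 // oner_neq0.
have := cvgM (cvg_horner_inv R (qfactors R n k w))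
             (cvgV nz (cvg_horner_inv R (qfactors R k k w))).
by rewrite !qfactors0 // invr1 mulr1; apply.
Qed.

Lemma near_prime_powers (P : nat -> Prop) :
  (forall q, prime_power q -> (1 < q)%N -> P q) ->
  \forall q \near prime_powers_oo, P q.
Proof.
by move=> h; exists 2 => // q /= q1 qpp; exact: h.
Qed.

Lemma cvg_beta_dominant (R : realType) (n d k : nat) :
  (0 < d)%N -> (0 < k <= n - d)%N ->
  ((fun q : nat => (beta k q n d)%:R / q%:R ^+ dominant_exponent n d k : R)
     @ prime_powers_oo --> ('C(n, d)%:R : R))%classic.
Proof.
move=> d0 hk; have kn : (k <= n)%N by lia.
pose U (q : nat) : R :=
   (ball_poly R n d).[q%:R^-1] * gauss_tail R n k 1 q%:R^-1.
pose E (q : nat) : R := q%:R^-1 ^+ (n - k - (d - 1)) *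
   ((ball_poly R n d).[q%:R^-1] ^+ 2 * gauss_tail R n k 2 q%:R^-1).
have cB : ((fun q : nat => (ball_poly R n d).[q%:R^-1])
     @ prime_powers_oo --> ('C(n, d)%:R : R))%classic.
  by rewrite -(ball_poly0 R n d d0); exact: cvg_horner_inv.
have cU : (U @ prime_powers_oo --> ('C(n, d)%:R : R))%classic.
  by rewrite -[_%:R]mulr1; apply: cvgM => //; exact: cvg_gauss_tail.
have cE : (E @ prime_powers_oo --> (0 : R))%classic.
  rewrite -(mul0r ('C(n, d)%:R ^+ 2 * 1)); apply: cvgM.
    have := cvg_horner_inv R ('X^(n - k - (d - 1))).
    rewrite hornerXn expr0n (_ : _ == _ = false); last by lia.
    by under eq_fun do rewrite hornerXn.
  apply: cvgM; last exact: cvg_gauss_tail.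
  by rewrite expr2; under eq_fun do rewrite expr2; exact: cvgM.
apply: (squeeze_cvgr (f := U \- E) (h := U)) => //; last first.
  by rewrite -[_%:R]subr0; apply: cvgB.
apply: near_prime_powers => q qpp q1.
have := low_distance_codes_squeeze R (GF q) n d k d0 hk.
by rewrite (card_GF qpp) /low_distance_codes cardsE.
Qed.

Lemma cvg_beta_large_dim (R : realType) (n d k : nat) :
  (n - d < k <= n)%N ->
  ((fun q : nat => (beta k q n d)%:R / q%:R ^+ (k * (n - k)) : R)
     @ prime_powers_oo --> (1 : R))%classic.
Proof.
move=> /andP[dk kn].
apply: cvg_trans (cvg_gauss_tail R n k 0 kn); apply: near_eq_cvg.
apply: near_prime_powers => q qpp q1.
have -> : beta k q n d = #|subspaces_over (0 : {vspace 'rV[GF q]_n})%VS k|.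
  apply: eq_card => C; rewrite !inE sub0v /=; apply: andb_idr => /eqP dC.
  by apply: singleton_bound; rewrite dC.
rewrite (card_subspaces_over_real R (GF q) n k 0) ?dimv0 // (card_GF qpp) subn0.
by rewrite mulnC mulrC mulKf // expf_neq0 // pnatr_eq0; lia.
Qed.

(** * From limits of ratios to asymptotic relations *)

Lemma cvg_ratio_littleo (R : realType) (T : Type) (F : filter_on T)
    (f g : T -> R) (c : R) :
  (\forall q \near F, 0 < g q) -> ((fun q => f q / g q) @ F --> c)%classic ->
  f = (fun q => c * g q) +o_F g.
Proof.
move=> g0 /cvgrPdist_le fg; apply/eqaddoP => e e0.
have := fg e e0; apply: filter_app; apply: filterS g0 => q g0 /= h.
have -> : (f - (fun q => c * g q)) q = - ((c - f q / g q) * g q).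
  by rewrite mulrBl divfK ?gt_eqF // opprB.
by rewrite normrN normrM ler_wpM2r.
Qed.

Lemma littleo_scale (R : realType) (T : Type) (F : filter_on T)
    (f h g : T -> R) (c : R) :
  c != 0 -> f = h +o_F g -> f = h +o_F (fun q => c * g q).
Proof.
move=> c0 /eqaddoP fh; apply/eqaddoP => e e0.
have ec0 : 0 < e * `|c| by rewrite mulr_gt0 // normr_gt0.
have := fh _ ec0.
by apply: filterS => q; rewrite normrM mulrA.
Qed.

Lemma cvg_ratio_bigO (R : realType) (T : Type) (F : filter_on T)
    (f g : T -> R) (c : R) :
  (\forall q \near F, 0 < g q) -> ((fun q => f q / g q) @ F --> c)%classic ->
  f =O_F g.
Proof.
move=> g0 /cvgrPdist_le fg; apply/eqO_exP; exists (`|c| + 1).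
  by rewrite ltr_wpDl.
have := fg 1 ltr01; apply: filter_app; apply: filterS g0 => q g0 /= h.
have -> : f q = (c - (c - f q / g q)) * g q by rewrite subKr divfK ?gt_eqF.
by rewrite normrM ler_wpM2r // (le_trans (ler_normB _ _)) // lerD2l.
Qed.

Theorem theorem9p2 (R : realType) (n d : nat) (hd : (2 <= d)%N) (hdn : (d < n)%N) :
  [/\ forall k : nat, (1 <= k <= n - d)%N ->
        (fun q : nat => (beta k q n d)%:R : R)
        = (fun q : nat => 'C(n, d)%:R * q%:R ^+ ((k - 1) * (n - k) + d - 1))
          +o_prime_powers_oo
          (fun q : nat => q%:R ^+ ((k - 1) * (n - k) + d - 1) : R),
      forall k : nat, (1 <= k <= n)%N ->
        (fun q : nat => (beta k q n d)%:R : R)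
        ~_prime_powers_oo
        (fun q : nat => (if (k <= n - d)%N
                        then 'C(n, d)%:R * q%:R ^+ ((k - 1) * (n - k) + d - 1)
                        else q%:R ^+ (k * (n - k))) : R)
    & forall k : nat, (1 <= k <= n)%N ->
        (fun q : nat => (beta k q n d)%:R : R)
        =O_prime_powers_oo
        (fun q : nat => q%:R ^+ ((k - 1) * (n - k) + d - 1) : R) ].
Proof.
(* The packed filter that the Landau notations of the statement refer to. *)
pose F : filter_on nat := within_filter_on prime_power eventually_filterType.
have pos e : \forall q \near F, 0 < q%:R ^+ e :> R.
  by apply: near_prime_powers => q _ q1; rewrite exprn_gt0 // ltr0n; lia.
have d0 : (0 < d)%N by lia.
have part1 k : (1 <= k <= n - d)%N ->
    (fun q : nat => (beta k q n d)%:R : R)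
        = (fun q : nat => 'C(n, d)%:R * q%:R ^+ ((k - 1) * (n - k) + d - 1))
          +o_F (fun q : nat => q%:R ^+ ((k - 1) * (n - k) + d - 1) : R).
  move=> hk.
  exact: cvg_ratio_littleo (pos _) (cvg_beta_dominant R n d k d0 hk).
split; first exact: part1.
  move=> k /andP[k0 kn]; case: (leqP k (n - d)) => knd.
    have c0 : 'C(n, d)%:R != 0 :> R by rewrite pnatr_eq0 -lt0n bin_gt0 ltnW.
    have hk : (1 <= k <= n - d)%N by rewrite k0.
    exact: (littleo_scale _ _ _ _ _ _ _ c0 (part1 k hk)).
  have hk : (n - d < k <= n)%N by rewrite knd.
  have := @cvg_ratio_littleo R nat F _ _ _ (pos _) (cvg_beta_large_dim R n d k hk).
  suff -> : (fun q : nat => 1 * q%:R ^+ (k * (n - k)) : R) =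
            (fun q : nat => q%:R ^+ (k * (n - k))) by exact.
  by apply/funext => q; rewrite mul1r.
move=> k /andP[k0 kn]; have [knd|knd] := leqP k (n - d).
  have hk : (0 < k <= n - d)%N by rewrite k0.
  exact: (@cvg_ratio_bigO R nat F _ _ _ (pos _)
            (cvg_beta_dominant R n d k d0 hk)).
have hk : (n - d < k <= n)%N by rewrite knd.
have /eqO_exP[c c0 hc] :=
  @cvg_ratio_bigO R nat F _ _ _ (pos _) (cvg_beta_large_dim R n d k hk).
(* Here n - k <= d - 1, so k (n - k) is at most the exponent of the claim. *)
apply/(@eqO_exP _ _ _ _ F); exists c => //; near=> q.
apply: le_trans (_ : _ <= c * `|q%:R ^+ (k * (n - k))|) _; first by near: q.
rewrite ler_pM2l // !ger0_norm ?exprn_ge0 // ler_weXn2l //; last by nia.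
near: q; apply: near_prime_powers => q _ q1; rewrite ler1n; lia.
Unshelve. all: by end_near.
Qed.
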